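(* Let $T$ be a continuous t-norm, let $(b_i)_{i\in\mathbb N}$ be positive numbers with $\sum_{i=1}^\infty b_i<+\infty$, and for each $i\in\mathbb N$ let $m_i\in M_{b_i}$ be $\tau_T$-superadditive. Let $\{(V_i,\nu^im_i,\mathbf T,\mathbf T)\mid i\in\mathbb N\}$ be a countable family of (proper) PN spaces, where $\nu^i:V_i\to\Delta^+$ and $(\nu^im_i)(p_i):=\nu^i_{p_i}m_i$. Let $V=\prod_{i=1}^\infty V_i$ and $G_{\bar p}:=\mathbf T^\infty(\nu^i_{p_i}m_i)$ for $\bar p=(p_i)\in V$. Then the pair $(V,G)$ is a PN space under $\mathbf T$, i.e. $(V,G,\mathbf T,\mathbf T)$ is a PN space.
   Context: $\Delta^+$ is the set of distance distribution functions: nondecreasing $F:[0,+\infty]\to[0,1]$ with $F(0)=0$, $F(+\infty)=1$, left-continuous on $(0,+\infty)$, ordered pointwise and endowed with the topology of weak convergence. $\epsilon_a$ is the unit step at $a\ge0$: $0$ on $[0,a]$ and $1$ on $]a,+\infty]$. A triangle function is a binary operation on $\Delta^+$ that is commutative, associative, nondecreasing in each argument and has $\epsilon_0$ as identity; continuity refers to weak convergence. A t-norm is a commutative, associative operation on $[0,1]$, nondecreasing in each variable, with identity $1$; $\tau_T(F,G)(x)=\sup_{s+t=x}T(F(s),G(t))$ and $\mathbf T(F,G)(x)=T(F(x),G(x))$. A PN space is a quadruple $(V,\nu,\tau,\tau^* )$ where $V$ is a real linear space with null vector $\theta$, $\tau,\tau^*$ are continuous triangle functions with $\tau\le\tau^*$,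 and $\nu:V\to\Delta^+$, $p\mapsto\nu_p$, satisfies: (N1) $\nu_p=\epsilon_0$ iff $p=\theta$; (N2) $\nu_{-p}=\nu_p$; (N3) $\nu_{p+q}\ge\tau(\nu_p,\nu_q)$; (N4) $\nu_p\le\tau^*(\nu_{\alpha p},\nu_{(1-\alpha)p})$ for all $\alpha\in[0,1]$; for all $p,q\in V$. It is proper if $\tau(\epsilon_s,\epsilon_t)\ge\epsilon_{s+t}$ for all $s,t\ge0$ (automatic for $\tau=\mathbf T$). For $0<b<+\infty$, $M_b$ is the set of continuous strictly increasing functions $m$ from $[0,b]$ onto $[0,+\infty]$. For $F\in\Delta^+$ and $m\in M_b$: $(Fm)(x)=F(m(x))$ for $x\in[0,b[$, $(Fm)(b)=\lim_{x\to b^-}F(m(x))$, $(Fm)(x)=1$ for $x>b$. The function $m$ is $\tau_T$-superadditive if $\tau_T(F,G)m\ge\tau_T(Fm,Gm)$ for all $F,G\in\Delta^+$. For a sequence $(F_n)$ in $\Delta^+$, let $T^1=T$, $T^{n+1}(x_1,\dots,x_{n+2})=T(T^n(x_1,\dots,x_{n+1}),x_{n+2})$; $\mathbf T^\infty F_n\in\Delta^+$ is the left-continuous regularization on $(0,+\infty)$ (with value $0$ at $0$ and $1$ at $+\infty$), i.e. the left limit, of the function $x\mapsto\lim_{n\to\infty}T^n(F_1(x),\dots,F_{n+1}(x))$. The product $V$ has componentwise linear operations. *)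

(* Defs.v *)
From HB Require Import structures.
From mathcomp Require Import all_boot all_order all_algebra.
From mathcomp Require Import all_classical all_reals all_analysis.

Set Implicit Arguments.
Unset Strict Implicit.
Unset Printing Implicit Defensive.

Import Order.TTheory GRing.Theory Num.Theory.
Import numFieldNormedType.Exports.

Local Open Scope classical_set_scope.
Local Open Scope ring_scope.

(* A distance distribution function is a function on [0, +oo]; it is encoded
   by its extension by 0 to the negative half-line, so that equality and the
   pointwise order on [0, +oo] coincide with those on \bar R.  Operations on
   distribution functions are total on [\bar R -> R], and their properties
   are only required on functions satisfying [is_ddf]. *)
Record is_ddf {R : realType} (F : \bar R -> R) : Prop := IsDdf {
  ddf_range : forall x, F x \in `[0, 1] ;
  ddf_nondecreasing : {homo F : x y / (x <= y)%E >-> x <= y} ;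
  ddf_le0 : forall x, (x <= 0)%E -> F x = 0 ;
  ddf_pinfty : F +oo%E = 1 ;
  ddf_left_continuous : forall x : R, 0 < x ->
    F y%:E @[y --> x^'-] --> F x%:E }.

Definition ddf_le {R : realType} (F G : \bar R -> R) : Prop :=
  forall x, F x <= G x.

Definition eps {R : realType} (a : R) (x : \bar R) : R :=
  if (a%:E < x)%E then 1 else 0.

(* Convergence at the continuity points of the limit; at 0 and at +oo it
   holds trivially. *)
Definition weak_cvg {R : realType} (F_ : nat -> \bar R -> R) (F : \bar R -> R)
    : Prop :=
  forall x : R, 0 < x -> {for x, continuous (fun y : R => F y%:E)} ->
    F_ n x%:E @[n --> \oo] --> F x%:E.

Record is_triangle_function {R : realType}
    (tau : (\bar R -> R) -> (\bar R -> R) -> \bar R -> R) : Prop :=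
  IsTriangleFunction {
  triangle_ddf : forall F G, is_ddf F -> is_ddf G -> is_ddf (tau F G) ;
  triangleC : forall F G, is_ddf F -> is_ddf G -> tau F G = tau G F ;
  triangleA : forall F G H, is_ddf F -> is_ddf G -> is_ddf H ->
    tau F (tau G H) = tau (tau F G) H ;
  triangle_le : forall F F' G G',
    is_ddf F -> is_ddf F' -> is_ddf G -> is_ddf G' ->
    ddf_le F F' -> ddf_le G G' -> ddf_le (tau F G) (tau F' G') ;
  triangle_eps0 : forall F, is_ddf F -> tau F (eps 0) = F }.

(* The topology of weak convergence is metrizable (by the modified Levy
   metric), hence continuity is expressed with sequences. *)
Definition triangle_continuous {R : realType}
    (tau : (\bar R -> R) -> (\bar R -> R) -> \bar R -> R) : Prop :=
  forall (F_ G_ : nat -> \bar R -> R) (F G : \bar R -> R),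
    (forall n, is_ddf (F_ n)) -> (forall n, is_ddf (G_ n)) ->
    is_ddf F -> is_ddf G ->
    weak_cvg F_ F -> weak_cvg G_ G ->
    weak_cvg (fun n => tau (F_ n) (G_ n)) (tau F G).

(* The values of [T] outside the unit square are irrelevant. *)
Record is_tnorm {R : realType} (T : R -> R -> R) : Prop := IsTnorm {
  tnorm_range : {in `[0, 1] &, forall a b, T a b \in `[0, 1]} ;
  tnormC : {in `[0, 1] &, forall a b, T a b = T b a} ;
  tnormA : {in `[0, 1] & &, forall a b c, T a (T b c) = T (T a b) c} ;
  tnorm_le : {in `[0, 1] & &, forall a a' b, a <= a' -> T a b <= T a' b} ;
  tnorm_ler : {in `[0, 1] & &, forall a b b', b <= b' -> T a b <= T a b'} ;
  tnorm1 : {in `[0, 1], forall a, T a 1 = a} }.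

Definition tnorm_continuous {R : realType} (T : R -> R -> R) : Prop :=
  {within `[0, 1]%classic `*` `[0, 1]%classic,
    continuous (fun p : R * R => T p.1 p.2)}.

Definition tau_of {R : realType} (T : R -> R -> R) (F G : \bar R -> R)
    (x : \bar R) : R :=
  sup [set z | exists s t : \bar R,
    [/\ (0 <= s)%E, (0 <= t)%E, (s + t)%E = x & z = T (F s) (G t)]].

Definition pointwise_of {R : realType} (T : R -> R -> R) (F G : \bar R -> R)
    (x : \bar R) : R :=
  T (F x) (G x).

Record is_PN_space {R : realType} (V : lmodType R) (nu : V -> \bar R -> R)
    (tau taus : (\bar R -> R) -> (\bar R -> R) -> \bar R -> R) : Prop :=
  IsPNSpace {
  PN_tau_triangle : is_triangle_function tau ;
  PN_tau_continuous : triangle_continuous tau ;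
  PN_taus_triangle : is_triangle_function taus ;
  PN_taus_continuous : triangle_continuous taus ;
  PN_tau_le : forall F G, is_ddf F -> is_ddf G -> ddf_le (tau F G) (taus F G) ;
  PN_ddf : forall p, is_ddf (nu p) ;
  PN_N1 : forall p, nu p = eps 0 <-> p = 0 ;
  PN_N2 : forall p, nu (- p) = nu p ;
  PN_N3 : forall p q, ddf_le (tau (nu p) (nu q)) (nu (p + q)) ;
  PN_N4 : forall p (a : R), a \in `[0, 1] ->
    ddf_le (nu p) (taus (nu (a *: p)) (nu ((1 - a) *: p))) }.

Definition is_proper_PN_space {R : realType} (V : lmodType R)
    (nu : V -> \bar R -> R)
    (tau taus : (\bar R -> R) -> (\bar R -> R) -> \bar R -> R) : Prop :=
  is_PN_space nu tau taus /\
  forall s t : R, 0 <= s -> 0 <= t ->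
    ddf_le (eps (s + t)) (tau (eps s) (eps t)).

(* The values of [m] outside [0, b] are irrelevant. *)
Record is_M {R : realType} (b : R) (m : R -> \bar R) : Prop := IsM {
  M_continuous : {within `[0, b]%classic, continuous m} ;
  M_increasing : {in `[0, b] &, {homo m : x y / x < y >-> (x < y)%E}} ;
  M_onto : m @` `[0, b]%classic = [set y | (0 <= y)%E] }.

(* F composed with m in M_b; the value at b is a left limit, which may differ
   from F (m b) = F +oo = 1. *)
Definition ddf_comp {R : realType} (F : \bar R -> R) (b : R) (m : R -> \bar R)
    (x : \bar R) : R :=
  match x with
  | r%:E => if r < 0 then 0
            else if r < b then F (m r)
            else if r == b then lim (F (m y) @[y --> b^'-])
            else 1
  | +oo%E => 1
  | -oo%E => 0
  end.

Definition tau_superadditive {R : realType} (T : R -> R -> R) (b : R)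
    (m : R -> \bar R) : Prop :=
  forall F G, is_ddf F -> is_ddf G ->
    ddf_le (tau_of T (ddf_comp F b m) (ddf_comp G b m))
           (ddf_comp (tau_of T F G) b m).

(* [tnorm_iter T x n] is T^n(x_0, ..., x_n) for n > 0. *)
Fixpoint tnorm_iter {R : realType} (T : R -> R -> R) (x : nat -> R) (n : nat)
    : R :=
  if n is n'.+1 then T (tnorm_iter T x n') (x n) else x 0%N.

Definition tnorm_lim {R : realType} (T : R -> R -> R)
    (F_ : nat -> \bar R -> R) (x : \bar R) : R :=
  lim (tnorm_iter T (fun i => F_ i x) n @[n --> \oo]).

Definition pointwise_infty {R : realType} (T : R -> R -> R)
    (F_ : nat -> \bar R -> R) (x : \bar R) : R :=
  match x with
  | r%:E => if r <= 0 then 0 else lim (tnorm_lim T F_ y%:E @[y --> r^'-])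
  | +oo%E => 1
  | -oo%E => 0
  end.

Definition prod_lmod {R : realType} (V : nat -> lmodType R) : Type :=
  forall i, V i.

Section prod_lmod.
Context {R : realType} (V : nat -> lmodType R).
Implicit Types p q : prod_lmod V.

HB.instance Definition _ := gen_eqMixin (prod_lmod V).
HB.instance Definition _ := gen_choiceMixin (prod_lmod V).

Definition prod_zero : prod_lmod V := fun=> 0.
Definition prod_opp p : prod_lmod V := fun i => - p i.
Definition prod_add p q : prod_lmod V := fun i => p i + q i.
Definition prod_scale (a : R) p : prod_lmod V := fun i => a *: p i.

Lemma prod_addA : associative prod_add.
Proof. by move=> p q r; apply: functional_extensionality_dep => i; apply: addrA. Qed.
Lemma prod_addC : commutative prod_add.
Proof. by move=> p q; apply: functional_extensionality_dep => i; apply: addrC. Qed.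
Lemma prod_add0 : left_id prod_zero prod_add.
Proof. by move=> p; apply: functional_extensionality_dep => i; apply: add0r. Qed.
Lemma prod_addN : left_inverse prod_zero prod_opp prod_add.
Proof. by move=> p; apply: functional_extensionality_dep => i; apply: addNr. Qed.

HB.instance Definition _ := GRing.isZmodule.Build (prod_lmod V)
  prod_addA prod_addC prod_add0 prod_addN.

Lemma prod_scaleA a b p : prod_scale a (prod_scale b p) = prod_scale (a * b) p.
Proof. by apply: functional_extensionality_dep => i; apply: scalerA. Qed.
Lemma prod_scale1 : left_id 1 prod_scale.
Proof. by move=> p; apply: functional_extensionality_dep => i; apply: scale1r. Qed.
Lemma prod_scaleDr : right_distributive prod_scale +%R.
Proof. by move=> a p q; apply: functional_extensionality_dep => i; apply: scalerDr. Qed.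
Lemma prod_scaleDl p : {morph prod_scale^~ p : a b / a + b}.
Proof. by move=> a b; apply: functional_extensionality_dep => i; apply: scalerDl. Qed.

HB.instance Definition _ := GRing.Zmodule_isLmodule.Build R (prod_lmod V)
  prod_scaleA prod_scale1 prod_scaleDr prod_scaleDl.

End prod_lmod.

(* Main.v *)
(** The iterates T^n(x_1, ..., x_{n+1}) decrease in n, so they converge, and
    T^n (T(x_i, y_i))_i = T (T^n x, T^n y) by associativity and commutativity.
    Continuity of T carries this identity through the limit in n and then
    through the left limit, so a coordinatewise inequality between F_i and
    T(G_i, H_i) passes to the infinite products, which gives N3 and N4.  For
    N1, the infinite product lies below each of its factors; if it is eps_0,
    then so are they all.  The axioms on the triangle function are those of
    any one of the factors. *)
Require Import Defs.
From mathcomp Require Import all_boot all_order all_algebra.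
From mathcomp Require Import all_classical all_reals all_analysis.
Import Order.TTheory GRing.Theory Num.Theory.
Import numFieldNormedType.Exports.
Local Open Scope classical_set_scope.
Local Open Scope ring_scope.

Set Implicit Arguments.
Unset Strict Implicit.
Unset Printing Implicit Defensive.

(** * Left limits of a bounded nondecreasing function *)

Section left_limit.
Context {R : realType} (L : R -> R) (c : R).
Hypotheses (L_nd : {homo L : x y / x <= y}) (L_le : forall x, L x <= c).

Lemma left_lim_is_cvg x : cvg (L y @[y --> x^'-]).
Proof.
apply: nondecreasing_at_left_is_cvgr; near=> z.
  by move=> u v _ _; exact: L_nd.
by exists c => _ [u _ <-].
Unshelve. all: by end_near. Qed.

Lemma left_lim_ge x y : y < x -> L y <= lim (L z @[z --> x^'-]).
Proof.
move=> yx; apply: limr_ge; first exact: left_lim_is_cvg.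
by near=> z; apply: L_nd; apply: ltW; near: z; exact: nbhs_left_gt.
Unshelve. all: by end_near. Qed.

Lemma left_lim_le x d : (forall y, y < x -> L y <= d) ->
  lim (L z @[z --> x^'-]) <= d.
Proof.
move=> Ld; apply: limr_le; first exact: left_lim_is_cvg.
by near=> z; apply: Ld; near: z; exact: nbhs_left_lt.
Unshelve. all: by end_near. Qed.

(** The regularization by left limits produces a left-continuous function; this is what makes the
    infinite product a distribution function. *)
Lemma left_lim_left_continuous x :
  lim (L y @[y --> z^'-]) @[z --> x^'-] --> lim (L y @[y --> x^'-]).
Proof.
apply/cvgrPdist_le => e e0.
(* [y] is fixed first, with [L y] within [e] of the left limit at [x]. For [z] between [y] and [x],
   the left limit at [z] lies between [L y] and the left limit at [x]. *)
near x^'- => y.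
have yx : y < x by near: y; exact: nbhs_left_lt.
have ye : `|lim (L y @[y --> x^'-]) - L y| <= e.
  by near: y; move/cvgrPdist_le: (@left_lim_is_cvg x); exact.
near=> z.
have yz : y < z by near: z; exact: nbhs_left_gt.
have zx : z < x by near: z; exact: nbhs_left_lt.
have le_zx : lim (L y @[y --> z^'-]) <= lim (L y @[y --> x^'-]).
  by apply: left_lim_le => u uz; apply: left_lim_ge; exact: lt_trans zx.
rewrite ger0_norm ?subr_ge0//.
rewrite (le_trans _ ye)// (le_trans _ (ler_norm _))// lerB//.
exact: left_lim_ge.
Unshelve. all: by end_near. Qed.

End left_limit.

(** * T-norms on the unit interval and their iterates *)

Section tnorm.
Context {R : realType} (T : R -> R -> R) (T_tnorm : is_tnorm T).
Implicit Types x y : nat -> R.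

Local Notation unitI u := (u \in `[0, 1]).

Let unit0 : unitI (0 : R). Proof. by rewrite in_itv/= lexx ler01. Qed.
Let unit1 : unitI (1 : R). Proof. by rewrite in_itv/= lexx ler01. Qed.
Let unit_ge0 (u : R) : unitI u -> 0 <= u. Proof. by rewrite in_itv => /andP[]. Qed.
Let unit_le1 (u : R) : unitI u -> u <= 1. Proof. by rewrite in_itv => /andP[]. Qed.

Lemma tnorm_mono u u' v v' : unitI u -> unitI u' -> unitI v -> unitI v' ->
  u <= u' -> v <= v' -> T u v <= T u' v'.
Proof.
move=> hu hu' hv hv' uu' vv'.
apply: le_trans (tnorm_ler T_tnorm hu' hv hv' vv').
exact: tnorm_le T_tnorm _ _ _ hu hu' hv uu'.
Qed.

Lemma tnorm_le_l u v : unitI u -> unitI v -> T u v <= u.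
Proof.
by move=> hu hv; rewrite -{2}(tnorm1 T_tnorm hu) tnorm_mono// unit_le1.
Qed.

Lemma tnorm_le_r u v : unitI u -> unitI v -> T u v <= v.
Proof. by move=> hu hv; rewrite (tnormC T_tnorm)// tnorm_le_l. Qed.

Lemma tnorm00 : T 0 0 = 0.
Proof.
apply/eqP; rewrite eq_le tnorm_le_l//=.
by rewrite unit_ge0// (tnorm_range T_tnorm).
Qed.

(** The interchange law, which is the inductive step of [tnorm_iterM]. *)
Lemma tnormACA u v w z : unitI u -> unitI v -> unitI w -> unitI z ->
  T (T u v) (T w z) = T (T u w) (T v z).
Proof.
move=> hu hv hw hz; have hT := tnorm_range T_tnorm.
rewrite -(tnormA T_tnorm) ?hT// (tnormA T_tnorm hv)//.
by rewrite (tnormC T_tnorm hv)// -(tnormA T_tnorm hw)// (tnormA T_tnorm hu) ?hT.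
Qed.

Lemma tnorm_iter_range x n : (forall i, unitI (x i)) -> unitI (tnorm_iter T x n).
Proof.
by move=> hx; elim: n => [|n IHn] //=; exact: tnorm_range T_tnorm _ _ IHn (hx _).
Qed.

Lemma tnorm_iter_mono x y n : (forall i, unitI (x i)) -> (forall i, unitI (y i)) ->
  (forall i, x i <= y i) -> tnorm_iter T x n <= tnorm_iter T y n.
Proof.
move=> hx hy xy; elim: n => [|n IHn] //=.
by apply: tnorm_mono => //; exact: tnorm_iter_range.
Qed.

Lemma tnorm_iterM x y n : (forall i, unitI (x i)) -> (forall i, unitI (y i)) ->
  tnorm_iter T (fun i => T (x i) (y i)) n
  = T (tnorm_iter T x n) (tnorm_iter T y n).
Proof.
move=> hx hy; elim: n => [|n IHn] //=.
by rewrite IHn tnormACA//; exact: tnorm_iter_range.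
Qed.

Lemma tnorm_iter1 n : tnorm_iter T (fun=> 1) n = 1.
Proof. by elim: n => [|n IHn] //=; rewrite IHn (tnorm1 T_tnorm). Qed.

(** Each further factor is at most the identity 1, so it can only lower the iterate. *)
Lemma tnorm_iter_nonincreasing x : (forall i, unitI (x i)) ->
  {homo tnorm_iter T x : m n / (m <= n)%N >-> n <= m}.
Proof.
move=> hx; apply/nonincreasing_seqP => n /=.
by apply: tnorm_le_l => //; exact: tnorm_iter_range.
Qed.

Lemma tnorm_iter_is_cvg x : (forall i, unitI (x i)) ->
  cvg (tnorm_iter T x n @[n --> \oo]).
Proof.
move=> hx; apply: nonincreasing_is_cvgn; first exact: tnorm_iter_nonincreasing.
by exists 0 => _ [n _ <-]; exact/unit_ge0/tnorm_iter_range.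
Qed.

Lemma tnorm_iter_le_nth x i : (forall i, unitI (x i)) -> tnorm_iter T x i <= x i.
Proof.
by case: i => [|i] //= hx; apply: tnorm_le_r => //; exact: tnorm_iter_range.
Qed.

(** * The infinite product as a distribution function *)

Section limit.
Variables (F_ : nat -> \bar R -> R).
Hypothesis F_ddf : forall i, is_ddf (F_ i).

Let F_unit (x : \bar R) i : unitI (F_ i x). Proof. exact: ddf_range. Qed.

Lemma tnorm_lim_range (x : \bar R) : unitI (tnorm_lim T F_ x).
Proof.
have cF := tnorm_iter_is_cvg (F_unit x).
rewrite in_itv/=; apply/andP; split.
  by apply: limr_ge => //; near=> n; exact/unit_ge0/tnorm_iter_range.
by apply: limr_le => //; near=> n; exact/unit_le1/tnorm_iter_range.
Unshelve. all: by end_near. Qed.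

Lemma tnorm_lim_nondecreasing :
  {homo tnorm_lim T F_ : x y / (x <= y)%E >-> x <= y}.
Proof.
move=> x y xy; apply: ler_lim; [exact: tnorm_iter_is_cvg..|].
by near=> n; apply: tnorm_iter_mono => // i; exact: ddf_nondecreasing.
Unshelve. all: by end_near. Qed.

Lemma tnorm_lim_le_nth (x : \bar R) i : tnorm_lim T F_ x <= F_ i x.
Proof.
apply: le_trans (tnorm_iter_le_nth i (F_unit x)).
apply: nonincreasing_cvgn_ge; first exact: tnorm_iter_nonincreasing.
exact: tnorm_iter_is_cvg.
Qed.

Let L (r : R) := tnorm_lim T F_ r%:E.
Let L_nd : {homo L : x y / x <= y}.
Proof. by move=> x y xy; apply: tnorm_lim_nondecreasing; rewrite lee_fin. Qed.
Let L_le1 r : L r <= 1. Proof. exact/unit_le1/tnorm_lim_range. Qed.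
Let L_ge0 r : 0 <= L r. Proof. exact/unit_ge0/tnorm_lim_range. Qed.

Lemma tnorm_lim_left_is_cvg (r : R) : cvg (tnorm_lim T F_ y%:E @[y --> r^'-]).
Proof. exact: (@left_lim_is_cvg _ L 1 L_nd L_le1 r). Qed.

(** For [y < r] the limit of the iterates at [y] is below [F_ i y], hence below [F_ i r] by
    monotonicity, and the left limit inherits this bound. *)
Lemma pointwise_infty_le_nth (r : R) i : pointwise_infty T F_ r%:E <= F_ i r%:E.
Proof.
rewrite /=; case: ifPn => r0; first exact/unit_ge0.
apply: (left_lim_le L_nd L_le1) => y yr.
apply: le_trans (tnorm_lim_le_nth _ i) _.
by apply: ddf_nondecreasing => //; rewrite lee_fin ltW.
Qed.

Lemma pointwise_infty_ddf : is_ddf (pointwise_infty T F_).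
Proof.
have range (x : \bar R) : unitI (pointwise_infty T F_ x).
  case: x => [r| |] //=; case: ifPn => // r0; rewrite in_itv/=; apply/andP; split.
    apply: le_trans (L_ge0 (r - 1)) _.
    by apply: (left_lim_ge L_nd L_le1); rewrite ltrBlDr ltrDl.
  exact: (left_lim_le L_nd L_le1).
split => //.
- case=> [r| |] [s| |] //; rewrite ?lee_fin.
  + move=> rs; have [r0|r0] := leP r 0.
      by rewrite [leLHS]/= r0; exact/unit_ge0/range.
    rewrite /= [r <= 0]leNgt r0/= [s <= 0]leNgt (lt_le_trans r0 rs)/=.
    apply: (left_lim_le L_nd L_le1) => y yr; apply: (left_lim_ge L_nd L_le1).
    exact: lt_le_trans rs.
  + by move=> _; apply: unit_le1; exact: range.
  + by move=> _; apply: unit_ge0; exact: range.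
- by case=> [r| |] //=; rewrite lee_fin => ->.
- move=> x x0; rewrite [X in _ --> X]/= leNgt x0/=.
  (* Points close to [x > 0] are positive, so there the infinite product is given by its left-limit
     branch. *)
  apply: cvg_trans (@left_lim_left_continuous _ L 1 L_nd L_le1 x).
  apply: near_eq_cvg; near=> z.
  by rewrite /= leNgt; have -> : 0 < z by near: z; exact: nbhs_left_gt.
Unshelve. all: by end_near. Qed.

End limit.

(** * Passing the product identity to the limits by continuity *)

Section continuous.
Hypothesis T_cont : tnorm_continuous T.

(** Continuity of [T] is relative to the closed unit square. Since [f] and [g] take values in the
    unit interval, the pair converges inside the square and the relative continuity applies. *)
Lemma tnorm_cvg {U : Type} (F : set_system U) {FF : Filter F} (f g : U -> R)
    (u v : R) : (forall t, unitI (f t)) -> (forall t, unitI (g t)) ->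
  unitI u -> unitI v -> f t @[t --> F] --> u -> g t @[t --> F] --> v ->
  T (f t) (g t) @[t --> F] --> T u v.
Proof.
move=> hf hg hu hv fu gv; have /subspace_continuousP /(_ (u, v)) T_uv := T_cont.
set A := _ `*` _ in T_uv.
have : (f t, g t) @[t --> F] --> within A (nbhs (u, v)).
  move=> W W_uv.
  have F_W : F (fun t => A (f t, g t) -> W (f t, g t)).
    exact: (cvg_pair fu gv W_uv).
  change (F (fun t => W (f t, g t))); apply: filterS F_W => t; apply.
  by split; [exact: hf|exact: hg].
move=> fg; apply: (cvg_comp _ _ fg (T_uv _)).
by split; [exact: hu|exact: hv].
Qed.

Lemma tnorm_limM (F_ G_ : nat -> \bar R -> R) (x : \bar R) :
  (forall i, is_ddf (F_ i)) -> (forall i, is_ddf (G_ i)) ->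
  tnorm_lim T (fun i => pointwise_of T (F_ i) (G_ i)) x
  = T (tnorm_lim T F_ x) (tnorm_lim T G_ x).
Proof.
move=> F_ddf G_ddf; apply: cvg_lim => //.
have hF i : unitI (F_ i x) by exact: ddf_range.
have hG i : unitI (G_ i x) by exact: ddf_range.
under eq_fun do rewrite tnorm_iterM//.
apply: tnorm_cvg => [n|n||||].
- exact: tnorm_iter_range.
- exact: tnorm_iter_range.
- exact: tnorm_lim_range.
- exact: tnorm_lim_range.
- exact: tnorm_iter_is_cvg.
- exact: tnorm_iter_is_cvg.
Qed.

Section pointwise_inftyM.
Variables (F_ G_ H_ : nat -> \bar R -> R).
Hypotheses (F_ddf : forall i, is_ddf (F_ i)) (G_ddf : forall i, is_ddf (G_ i))
  (H_ddf : forall i, is_ddf (H_ i)).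

Let FG_range (x : \bar R) i : unitI (pointwise_of T (F_ i) (G_ i) x).
Proof. by apply: (tnorm_range T_tnorm); exact: ddf_range. Qed.

(** By [tnorm_limM] the product splits at each [y]; continuity of [T] then handles the left limit of
    each factor. Both comparisons below rest on this. *)
Let cvg_inftyM (r : R) : 0 < r ->
  tnorm_lim T (fun i => pointwise_of T (F_ i) (G_ i)) y%:E @[y --> r^'-]
  --> pointwise_of T (pointwise_infty T F_) (pointwise_infty T G_) r%:E.
Proof.
move=> r0; under eq_fun do rewrite tnorm_limM//.
have infE (K_ : nat -> \bar R -> R) :
    pointwise_infty T K_ r%:E = lim (tnorm_lim T K_ y%:E @[y --> r^'-]).
  by rewrite /= leNgt r0.
apply: tnorm_cvg => [y|y||||]; [exact: tnorm_lim_range|exact: tnorm_lim_range|..].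
- by apply: ddf_range; exact: pointwise_infty_ddf.
- by apply: ddf_range; exact: pointwise_infty_ddf.
- by rewrite infE; exact: tnorm_lim_left_is_cvg.
- by rewrite infE; exact: tnorm_lim_left_is_cvg.
Qed.

(** This serves N3, with the families of [p], [q] and [p + q]. *)
Lemma pointwise_inftyM_le :
  (forall i, ddf_le (pointwise_of T (F_ i) (G_ i)) (H_ i)) ->
  ddf_le (pointwise_of T (pointwise_infty T F_) (pointwise_infty T G_))
         (pointwise_infty T H_).
Proof.
move=> FGH [r| |]; last 2 first.
- by rewrite /pointwise_of/= (tnorm1 T_tnorm).
- by rewrite /pointwise_of/= tnorm00.
have [r0|r0] := leP r 0; first by rewrite /pointwise_of/= r0 tnorm00.
rewrite [leRHS]/= [r <= 0]leNgt r0/=.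
(* Both sides are limits as [y] tends to [r] from the left, so they are compared at each [y], where
   the hypothesis orders every iterate. *)
apply: ler_cvg_to (cvg_inftyM r0) (@tnorm_lim_left_is_cvg _ H_ddf r) _.
near=> y; apply: ler_lim; [exact: tnorm_iter_is_cvg| |].
  by apply: tnorm_iter_is_cvg => i; exact: ddf_range.
near=> n; apply: tnorm_iter_mono => // i; first exact: ddf_range.
exact: FGH.
Unshelve. all: by end_near. Qed.

(** This serves N4, with the families of [a *: p], [(1 - a) *: p] and [p]. *)
Lemma pointwise_inftyM_ge :
  (forall i, ddf_le (H_ i) (pointwise_of T (F_ i) (G_ i))) ->
  ddf_le (pointwise_infty T H_)
         (pointwise_of T (pointwise_infty T F_) (pointwise_infty T G_)).
Proof.
move=> FGH [r| |]; last 2 first.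
- by rewrite /pointwise_of/= (tnorm1 T_tnorm).
- by rewrite /pointwise_of/= tnorm00.
have [r0|r0] := leP r 0; first by rewrite /pointwise_of/= r0 tnorm00.
rewrite [leLHS]/= [r <= 0]leNgt r0/=.
apply: ler_cvg_to (@tnorm_lim_left_is_cvg _ H_ddf r) (cvg_inftyM r0) _.
near=> y; apply: ler_lim; [|exact: tnorm_iter_is_cvg|].
  by apply: tnorm_iter_is_cvg => i; exact: ddf_range.
near=> n; apply: tnorm_iter_mono => // i; first exact: ddf_range.
exact: FGH.
Unshelve. all: by end_near. Qed.

End pointwise_inftyM.
End continuous.

(** At a positive point every iterate is a product of ones, hence 1; this gives the value at the
    null vector in N1. *)
Lemma pointwise_infty_eps0 :
  pointwise_infty T (fun=> eps 0) = eps 0 :> (\bar R -> R).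
Proof.
apply/funext => -[r| |] //=; rewrite /eps ?ltry//.
rewrite lte_fin; case: leP => // r0.
apply: lim_near_cst => //; near=> y.
have y0 : 0 < y by near: y; exact: nbhs_left_gt.
rewrite /tnorm_lim lte_fin y0; under eq_fun do rewrite tnorm_iter1.
exact: lim_cst.
Unshelve. all: by end_near. Qed.

(** The values off the positive reals are forced on every distribution function, and those on them
    are capped by 1. *)
Lemma ddf_eps0 (F : \bar R -> R) : is_ddf F ->
  (forall r : R, 0 < r -> 1 <= F r%:E) -> F = eps 0.
Proof.
move=> F_ddf F1; apply/funext => -[r| |]; rewrite /eps ?ltry ?(ddf_pinfty F_ddf)//.
  rewrite lte_fin; have [r0|r0] := ltP 0 r; last by rewrite (ddf_le0 F_ddf).
  by apply/eqP; rewrite eq_le F1// andbT unit_le1// ddf_range.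
by rewrite ltNge leNye (ddf_le0 F_ddf).
Qed.

End tnorm.

(** * The PN axioms for the countable product *)

Theorem theorem10 (R : realType) (T : R -> R -> R)
    (T_tnorm : is_tnorm T) (T_cont : tnorm_continuous T)
    (b : nat -> R) (b_gt0 : forall i, 0 < b i)
    (b_summable : (\sum_(0 <= i <oo) (b i)%:E < +oo)%E)
    (m : nat -> R -> \bar R) (m_M : forall i, is_M (b i) (m i))
    (m_superadd : forall i, tau_superadditive T (b i) (m i))
    (V : nat -> lmodType R) (nu : forall i, V i -> \bar R -> R)
    (nu_ddf : forall i (p : V i), is_ddf (nu i p))
    (V_PN : forall i, is_proper_PN_space
      (fun p : V i => ddf_comp (nu i p) (b i) (m i))
      (pointwise_of T) (pointwise_of T)) :
  is_PN_space
    (fun p : prod_lmod V =>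
      pointwise_infty T (fun i => ddf_comp (nu i (p i)) (b i) (m i)))
    (pointwise_of T) (pointwise_of T).
Proof.
have V_ddf i p := PN_ddf (V_PN i).1 p.
have F_ddf (p : prod_lmod V) i := V_ddf i (p i).
have [T_tri T_tricont _ _ _ _ _ _ _ _] := (V_PN 0%N).1.
split=> //.
- by move=> F G _ _ x.
- by move=> p; exact: pointwise_infty_ddf.
- move=> p; split=> [Gp|->].
    apply/functional_extensionality_dep => i; apply/(PN_N1 (V_PN i).1).
    (* At [r > 0] the infinite product is 1 and lies below the factor [i], so this factor is
       [eps 0]. *)
    apply: ddf_eps0 => // r r0.
    apply: le_trans (pointwise_infty_le_nth T_tnorm (F_ddf p) r i).
    by rewrite Gp /eps lte_fin r0.
  rewrite -(pointwise_infty_eps0 T_tnorm); congr pointwise_infty.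
  by apply/funext => i; exact/(PN_N1 (V_PN i).1).
- move=> p; congr pointwise_infty; apply/funext => i.
  exact: (PN_N2 (V_PN i).1).
- move=> p q; apply: pointwise_inftyM_le => // i.
  exact: (PN_N3 (V_PN i).1).
- move=> p a a01; apply: pointwise_inftyM_ge => // i.
  exact: (PN_N4 (V_PN i).1).
Qed.
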